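(* Assume $x(0)=x'(0)=0$. Then $x(t)\to0$ as $t\to\infty$ if and only if all three of the following hold: (1) $y_2(t)\to0$ as $t\to\infty$; (2) $\int_0^t\cos(\omega s)A(s)y_2(s)\,ds=o(A(t))$ as $t\to\infty$; (3) $\int_0^t\sin(\omega s)A(s)y_2(s)\,ds=o(A(t))$ as $t\to\infty$.
   Context: Standing assumptions: $\omega>0$ is a constant; $p\in C^1([0,\infty))$ with $p(t)>0$ and $p'(t)<0$ for all $t\ge0$, $\int_0^\infty p(t)\,dt=\infty$ and $\int_0^\infty p(t)^2\,dt<\infty$; $f\in L^1_{\mathrm{loc}}([0,\infty))$. $x$ denotes the solution of $x''(t)+p(t)x'(t)+\omega^2x(t)=f(t)$, $t\ge0$. Notation: $A(t)=\exp(\frac12\int_0^tp(s)\,ds)$ (so $A(t)\to\infty$); $y_1(t)=\int_0^te^{-\omega^2(t-s)}f(s)\,ds$; $y_2(t)=\int_0^te^{-\omega^2(t-s)}y_1(s)\,ds=\int_0^t(t-s)e^{-\omega^2(t-s)}f(s)\,ds$. *)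

(* Defs.v *)
From HB Require Import structures.
From mathcomp Require Import all_boot all_order all_algebra.
From mathcomp Require Import all_classical all_reals all_analysis.
Set Implicit Arguments. Unset Strict Implicit. Unset Printing Implicit Defensive.
Import Order.TTheory GRing.Theory Num.Theory.
Import numFieldNormedType.Exports.
Local Open Scope classical_set_scope.
Local Open Scope ring_scope.

Section Defs.
Variable R : realType.
Local Notation mu := (@lebesgue_measure R).

Definition int0 (g : R -> R) (t : R) : R := Rintegral mu `[0, t] g.

Definition Afun (p : R -> R) (t : R) : R := expR (2^-1 * int0 p t).

Definition y1 (w : R) (f : R -> R) (t : R) : R :=
  int0 (fun s => expR (- (w ^+ 2) * (t - s)) * f s) t.

Definition y2 (w : R) (f : R -> R) (t : R) : R :=
  int0 (fun s => expR (- (w ^+ 2) * (t - s)) * y1 w f s) t.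

Definition L1loc (f : R -> R) : Prop :=
  forall t : R, 0 <= t -> mu.-integrable `[0, t] (fun s => (f s)%:E).

(* x is a (Caratheodory) solution on [0, oo) of x'' + p x' + w^2 x = f:
   x is C^1 on [0,oo) with derivative v, v is absolutely continuous and
   v' = f - p v - w^2 x a.e.; written in the equivalent integrated form. *)
Definition is_solution (p : R -> R) (w : R) (f : R -> R) (x v : R -> R) : Prop :=
  {within `[0, +oo[, continuous v} /\
  forall t : R, 0 <= t ->
    x t = x 0 + int0 v t /\
    mu.-integrable `[0, t] (fun s => (f s - p s * v s - w ^+ 2 * x s)%:E) /\
    v t = v 0 + int0 (fun s => f s - p s * v s - w ^+ 2 * x s) t.

End Defs.

(* Register the filter of neighbourhoods of +oo on R as a filter_on, so that
   the library's Landau notation  g =o_ +oo h  can be used on R. *)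
Canonical pinfty_filter_on (R : realType) :=
  FilterType (pinfty_nbhs R) (@proper_pinfty_nbhs R).

(* Main.v *)
Require Import Defs.
From HB Require Import structures.
From mathcomp Require Import all_boot all_order all_algebra.
From mathcomp Require Import all_classical all_reals all_analysis.
From mathcomp Require Import ring lra.
Import Order.TTheory GRing.Theory Num.Theory.
Import numFieldNormedType.Exports.
Local Open Scope classical_set_scope.
Local Open Scope ring_scope.

(* With k = w^2 and y = y_2, one has (d/dt + k)^2 y = f, so z = x - y solves a
   damped equation in which f no longer occurs. If x -> 0, then y -> 0 because
   (d/dt + k)^2 z is a combination of x and of the derivative of a multiple of x,
   with bounded or integrable coefficients. If y -> 0, the substitution Z = A z
   removes the damping: Z'' + w^2 Z = q Z + forcing with q = p^2/4 + p'/2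
   integrable, and variation of constants expresses w Z, up to q Z and o(A), through
   the two integrals of A y against cos and sin. Gronwall's inequality then gives
   one implication. For the other, Z = o(A) controls only one combination of the
   two integrals; since they vary by o(A) over a quarter period, a shift by
   pi / (2 w) controls an independent one. *)

(** * Derivatives and primitives on the half-line *)

Section HalfLine.
Context {R : realType}.
Implicit Types F G f g h : R -> R.
Local Notation mu := (@lebesgue_measure R).

Definition C0 g := {within `[0, +oo[, continuous g}.

Lemma C0_ext F G : C0 F -> (forall t, 0 <= t -> F t = G t) -> C0 G.
Proof.
move=> cF FG; apply: (@subspace_eq_continuous _ _ _ F) => // t.
by rewrite inE/= in_itv/= andbT => /FG.
Qed.

Lemma C0_cst (c : R) : C0 (fun=> c).
Proof. by apply: continuous_subspaceT => ?; exact: cvg_cst. Qed.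

Lemma C0_id : C0 (fun t => t).
Proof. by apply: continuous_subspaceT => ?; exact: cvg_id. Qed.

Lemma C0D F G : C0 F -> C0 G -> C0 (fun t => F t + G t).
Proof. by move=> cF cG x; apply: cvgD; [exact: cF|exact: cG]. Qed.

Lemma C0N F : C0 F -> C0 (fun t => - F t).
Proof. by move=> cF x; apply: cvgN; exact: cF. Qed.

Lemma C0M F G : C0 F -> C0 G -> C0 (fun t => F t * G t).
Proof. by move=> cF cG x; apply: cvgM; [exact: cF|exact: cG]. Qed.

Lemma C0_norm F : C0 F -> C0 (fun t => `|F t|).
Proof. by move=> cF x; apply: cvg_norm; exact: cF. Qed.

Lemma C0_comp h F : continuous h -> C0 F -> C0 (fun t => h (F t)).
Proof.
by move=> ch cF x; apply: continuous_comp; [exact: cF|exact: ch].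
Qed.

Lemma C0_expR F : C0 F -> C0 (fun t => expR (F t)).
Proof. by apply: C0_comp; exact: continuous_expR. Qed.

Lemma C0_cos F : C0 F -> C0 (fun t => cos (F t)).
Proof. by apply: C0_comp; exact: continuous_cos. Qed.

Lemma C0_sin F : C0 F -> C0 (fun t => sin (F t)).
Proof. by apply: C0_comp; exact: continuous_sin. Qed.

Lemma C0_within g T : C0 g -> {within `[0, T], continuous g}.
Proof.
by apply: continuous_subspaceW => t/=; rewrite !in_itv/= andbT => /andP[].
Qed.

Lemma C0_at g t : C0 g -> 0 < t -> {for t, continuous g}.
Proof.
move=> /continuous_within_itvcyP[cg _] t0.
by apply: cg; rewrite in_itv/= t0.
Qed.

Lemma C0_of_within g :
  (forall T, 0 < T -> {within `[0, T], continuous g}) -> C0 g.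
Proof.
move=> cg; apply/continuous_within_itvcyP; split; last first.
  by have /(continuous_within_itvP _ ltr01)[] := cg _ ltr01.
move=> t; rewrite in_itv/= andbT => t0.
have t1 : 0 < t + 1 by rewrite addr_gt0.
apply: (within_continuous_continuous t1 (cg _ t1)).
by rewrite in_itv/= t0 ltrDl ltr01.
Qed.

Lemma C0_integrable g t : C0 g -> mu.-integrable `[0, t] (fun s => (g s)%:E).
Proof.
move=> cg; apply: continuous_compact_integrable.
  exact: segment_compact.
exact: C0_within.
Qed.

(** A two-sided derivative is asked for only at positive times: [int0 g] vanishes for negative
    arguments, so it need not be differentiable at 0. Continuity up to 0 is what monotonicity on the
    closed half-line requires there. *)
Definition D F g := C0 F /\ forall t : R, 0 < t -> is_derive t (1 : R) F (g t).

Lemma D_C0 F g : D F g -> C0 F. Proof. by case. Qed.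

Lemma D_ext F G f g : D F f -> (forall t, 0 <= t -> F t = G t) ->
  (forall t, 0 < t -> f t = g t) -> D G g.
Proof.
move=> [cF dF] FG fg; split; first exact: C0_ext cF FG.
move=> t t0; rewrite -fg//; apply: near_eq_is_derive (dF _ t0).
by near do apply/FG/ltW; exact: lt_nbhsr.
Unshelve. all: by end_near. Qed.

Lemma D_der F f g : D F f -> (forall t, 0 < t -> f t = g t) -> D F g.
Proof. by move=> dF; apply: D_ext dF _. Qed.

Lemma D_cst (c : R) : D (fun=> c) (fun=> 0).
Proof. by split; [exact: C0_cst|move=> t _; exact: is_derive_cst]. Qed.

Lemma D_id : D (fun t => t) (fun=> 1).
Proof. by split; [exact: C0_id|move=> t _; exact: is_derive_id]. Qed.

Lemma DD F f G g : D F f -> D G g -> D (fun t => F t + G t) (fun t => f t + g t).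
Proof.
move=> [cF dF] [cG dG]; split; first exact: C0D.
by move=> t t0; apply: is_deriveD; [exact: dF|exact: dG].
Qed.

Lemma DN F f : D F f -> D (fun t => - F t) (fun t => - f t).
Proof.
move=> [cF dF]; split; first exact: C0N.
by move=> t t0; apply: is_deriveN; exact: dF.
Qed.

Lemma DM F f G g : D F f -> D G g ->
  D (fun t => F t * G t) (fun t => F t * g t + G t * f t).
Proof.
move=> [cF dF] [cG dG]; split; first exact: C0M.
by move=> t t0; apply: is_deriveM; [exact: dF|exact: dG].
Qed.

Lemma D_expR F f : D F f -> D (fun t => expR (F t)) (fun t => expR (F t) * f t).
Proof.
move=> [cF dF]; split; first exact: C0_expR.
by move=> t t0; apply: (is_derive1_comp (f := expR)); exact: dF.
Qed.

Lemma D_sin F f : D F f -> D (fun t => sin (F t)) (fun t => cos (F t) * f t).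
Proof.
move=> [cF dF]; split; first exact: C0_sin.
by move=> t t0; apply: (is_derive1_comp (f := sin)); exact: dF.
Qed.

Lemma D_cos F f : D F f -> D (fun t => cos (F t)) (fun t => - sin (F t) * f t).
Proof.
move=> [cF dF]; split; first exact: C0_cos.
by move=> t t0; apply: (is_derive1_comp (f := cos)); exact: dF.
Qed.

(** Most integral estimates below apply this to a suitable difference, in which the integrals enter
    only through their derivatives. *)
Lemma D_nondecreasing F f T : 0 <= T -> D F f -> (forall t, T < t -> 0 <= f t) ->
  forall s t, T <= s -> s <= t -> F s <= F t.
Proof.
move=> T0 [cF dF] f0; apply: ger0_derive1_ndecry.
- move=> x; rewrite in_itv/= andbT => Tx.
  by have [] := dF x (le_lt_trans T0 Tx).
- move=> x; rewrite in_itv/= andbT => Tx; rewrite derive1E.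
  by have [_ ->] := dF x (le_lt_trans T0 Tx); exact: f0.
- apply: continuous_subspaceW cF => x/=; rewrite !in_itv/= !andbT.
  exact: le_trans.
Qed.

Lemma int0_0 g : int0 g 0 = 0.
Proof. by rewrite /int0 set_itv1 Rintegral_set1. Qed.

Lemma int0_L1loc_C0 g : L1loc g -> C0 (int0 g).
Proof.
move=> ig; apply: C0_of_within => T T0.
by apply: parameterized_integral_continuous (ltW T0) _; exact: ig (ltW T0).
Qed.

Lemma C0_int0 g : C0 g -> C0 (int0 g).
Proof. by move=> cg; apply: int0_L1loc_C0 => t _; exact: C0_integrable. Qed.

Lemma D_int0 g : C0 g -> D (int0 g) g.
Proof.
move=> cg; split; first exact: C0_int0.
move=> t t0; have tt1 : t < t + 1 by rewrite ltrDl ltr01.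
have [dI I'E] := continuous_FTC1_closed tt1 (C0_integrable g (t + 1) cg) t0
  (C0_at g t cg t0).
by apply: DeriveDef; [exact: dI|rewrite -derive1E].
Qed.

Lemma D_eq F G f : D F f -> D G f -> F 0 = G 0 ->
  forall t, 0 <= t -> F t = G t.
Proof.
move=> dF dG FG0 t t0; apply/eqP; rewrite eq_le.
have H F1 G1 : D F1 f -> D G1 f -> F1 0 = G1 0 -> F1 t <= G1 t.
  move=> dF1 dG1 E; rewrite -subr_ge0 -(subrr (G1 0)) -{2}E.
  apply: (D_nondecreasing (fun t => G1 t - F1 t) _ _ (lexx 0) (DD _ _ _ _ dG1 (DN _ _ dF1))) => //.
  by move=> ? _; rewrite subrr.
by rewrite !H.
Qed.

Lemma D_int0E F f : D F f -> C0 f -> forall t, 0 <= t -> F t = F 0 + int0 f t.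
Proof.
move=> dF cf; apply: (D_eq _ _ f) => //.
  apply: D_der (DD _ _ _ _ (D_cst (F 0)) (D_int0 _ cf)) _ => t _.
  exact: add0r.
by rewrite int0_0 addr0.
Qed.

End HalfLine.

Ltac C0_auto := cbv beta; lazymatch goal with
  | |- C0 (fun _ => ?c) => exact (C0_cst c)
  | |- C0 (fun t => t) => exact C0_id
  | |- C0 (fun t => @GRing.add _ (@?F t) (@?G t)) => refine (C0D F G _ _); C0_auto
  | |- C0 (fun t => @GRing.opp _ (@?F t)) => refine (C0N F _); C0_auto
  | |- C0 (fun t => @GRing.mul _ (@?F t) (@?G t)) => refine (C0M F G _ _); C0_auto
  | |- C0 (fun t => @Num.norm _ _ (@?F t)) => refine (C0_norm F _); C0_auto
  | |- C0 (fun t => expR (@?F t)) => refine (C0_expR F _); C0_auto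
  | |- C0 (fun t => cos (@?F t)) => refine (C0_cos F _); C0_auto
  | |- C0 (fun t => sin (@?F t)) => refine (C0_sin F _); C0_auto
  | |- C0 (fun t => int0 ?g t) => first [assumption | refine (C0_int0 g _); C0_auto]
  | |- C0 (int0 ?g) => first [assumption | refine (C0_int0 g _); C0_auto]
  | |- _ => first [assumption
      | match goal with H : D ?F _ |- C0 ?F => exact (D_C0 _ _ H) end]
  end.

Ltac D_auto := cbv beta; lazymatch goal with
  | |- D (fun _ => ?c) _ => exact (D_cst c)
  | |- D (fun t => t) _ => exact D_id
  | |- D (fun t => @GRing.add _ (@?F t) (@?G t)) _ =>
      refine (DD F _ G _ _ _); D_auto
  | |- D (fun t => @GRing.opp _ (@?F t)) _ => refine (DN F _ _); D_auto
  | |- D (fun t => @GRing.mul _ (@?F t) (@?G t)) _ =>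
      refine (DM F _ G _ _ _); D_auto
  | |- D (fun t => expR (@?F t)) _ => refine (D_expR F _ _); D_auto
  | |- D (fun t => cos (@?F t)) _ => refine (D_cos F _ _); D_auto
  | |- D (fun t => sin (@?F t)) _ => refine (D_sin F _ _); D_auto
  | |- _ => eassumption
  end.

(** [D_auto] builds the derivative as an existential variable along the syntax of the function; what
    remains is the pointwise identity, at positive times, with the derivative that is claimed. *)
Ltac D_solve := refine (D_der _ _ _ _ _); [solve [D_auto] | move=> ? ? /=].

(** * Integration by parts against a locally integrable function *)

Section LocallyIntegrable.
Context {R : realType}.
Implicit Types F G f g h phi : R -> R.
Local Notation mu := (@lebesgue_measure R).

Lemma C0_bounded g T : 0 <= T -> C0 g ->
  exists2 L, 0 <= L & forall t, 0 <= t -> t <= T -> `|g t| <= L.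
Proof.
move=> T0 cg; have [c _ cmax] := EVT_max T0 (C0_within _ T (C0_norm _ cg)).
exists `|g c| => // t t0 tT; apply: cmax.
by rewrite in_itv/= t0.
Qed.

Lemma L1loc_C0 g : C0 g -> L1loc g.
Proof. by move=> cg t _; exact: C0_integrable. Qed.

Lemma L1loc_norm f : L1loc f -> L1loc (fun t => `|f t|).
Proof. by move=> lf t t0; apply: integrable_norm (lf t t0). Qed.

Lemma L1locM phi f : C0 phi -> L1loc f -> L1loc (fun t => phi t * f t).
Proof.
move=> cphi lf t t0.
have [L L0 HL] := C0_bounded phi t t0 cphi.
apply: (@integrableMr _ _ _ mu _ _ phi _ _ _ (lf t t0)) => //.
  apply/measurable_realfun.measurable_EFinP.
  by have /integrableP[] := C0_integrable phi t cphi.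
exists L; split; first exact: num_real.
move=> M LM s /=; rewrite in_itv/= => /andP[s0 st].
exact: le_trans (HL _ s0 st) (ltW LM).
Qed.

Lemma int0Z (c : R) f t : 0 <= t -> L1loc f ->
  int0 (fun s => c * f s) t = c * int0 f t.
Proof. by move=> t0 lf; rewrite /int0 RintegralZl//; exact: lf. Qed.

Lemma int0B f g t : 0 <= t -> L1loc f -> L1loc g ->
  int0 (fun s => f s - g s) t = int0 f t - int0 g t.
Proof. by move=> t0 lf lg; rewrite /int0 RintegralB//; [exact: lf|exact: lg]. Qed.

Lemma eq_int0 f g t : (forall s, 0 <= s -> s <= t -> f s = g s) ->
  int0 f t = int0 g t.
Proof.
move=> fg; apply: eq_Rintegral => s; rewrite inE/= in_itv/= => /andP[].
exact: fg.
Qed.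

Lemma int0_incr f s t : 0 <= s -> s <= t -> L1loc f ->
  int0 f t - int0 f s = Rintegral mu `]s, t] f.
Proof.
move=> s0 st lf; rewrite /int0 Rintegral_itvB ?bnd_simp//.
by apply: lf; exact: le_trans st.
Qed.

Lemma le_int0_incr f g s t : 0 <= s -> s <= t -> L1loc f -> L1loc g ->
  (forall u, s < u -> u <= t -> `|f u| <= g u) ->
  `|int0 f t - int0 f s| <= int0 g t - int0 g s.
Proof.
move=> s0 st lf lg fg; rewrite !int0_incr//.
have sub : `]s, t] `<=` `[0, t].
  move=> u/=; rewrite !in_itv/= => /andP[su ->]; rewrite andbT.
  exact: le_trans s0 (ltW su).
have t0 := le_trans s0 st.
have I h : L1loc h -> mu.-integrable `]s, t] (EFin \o h).
  by move=> lh; apply: integrableS (lh t t0).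
apply: le_trans (le_normr_Rintegral _ (I _ lf)) _ => //.
apply: le_Rintegral => //.
- exact/I/L1loc_norm.
- exact: I.
- by move=> u/=; rewrite in_itv/= => /andP[]; exact: fg.
Qed.

Lemma int0_cst (c : R) t : 0 <= t -> int0 (fun=> c) t = c * t.
Proof.
move=> t0; have := D_int0E (fun t => c * t) (fun=> c) _ (C0_cst c) t t0.
rewrite mulr0 add0r => <- //; D_solve.
by rewrite mulr1 mulr0 addr0.
Qed.

(* Summed over n equal subdivisions of [0, T], the increments of Phi telescope and
   the factors t - s leave a bound of order 1 / n; no regularity of Phi is used. *)
Lemma eq0_of_increments (Delta Phi : R -> R) L T : 0 <= T -> 0 <= L ->
  Delta 0 = 0 -> Phi 0 = 0 ->
  (forall s t, 0 <= s -> s <= t -> t <= T ->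
    `|Delta t - Delta s| <= L * (t - s) * (Phi t - Phi s)) -> Delta T = 0.
Proof.
move=> T0 L0 D0 P0 H.
have step n i : (i <= n.+1)%N ->
    `|Delta (i%:R * (T / n.+1%:R))| <=
    L * (T / n.+1%:R) * Phi (i%:R * (T / n.+1%:R)).
  set h := T / _; have h0 : 0 <= h by rewrite divr_ge0.
  elim: i => [|i IHi] ilen; first by rewrite mul0r D0 P0 mulr0 normr0.
  have {}IHi := IHi (ltnW ilen).
  have le1 : i%:R * h <= i.+1%:R * h by rewrite ler_wpM2r// ler_nat.
  have le2 : i.+1%:R * h <= T.
    rewrite /h mulrA ler_pdivrMr ?ltr0n// [X in _ <= X]mulrC.
    by rewrite ler_wpM2r// ler_nat.
  have := H _ _ (mulr_ge0 (ler0n _ i) h0) le1 le2.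
  have -> : i.+1%:R * h - i%:R * h = h by rewrite -natr1; ring.
  have := ler_normD (Delta (i.+1%:R * h) - Delta (i%:R * h)) (Delta (i%:R * h)).
  rewrite subrK => ? ?; lra.
have bound n : `|Delta T| * n.+1%:R <= L * T * Phi T.
  have := step n n.+1 (leqnn _).
  have n0 : n.+1%:R != 0 :> R by rewrite pnatr_eq0.
  rewrite [n.+1%:R * _]mulrC divfK// => Hn.
  rewrite -ler_pdivlMr ?ltr0n//; apply: le_trans Hn _.
  by rewrite le_eqVlt; apply/orP; left; apply/eqP; field.
apply/eqP; rewrite -normr_le0 leNgt; apply/negP => d0.
(* [bound] holds for every [n], and this choice makes n + 1 exceed the ratio of [L * T * Phi T] to
   |Delta T|. *)
have := bound (Num.truncn (L * T * Phi T / `|Delta T|)).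
rewrite -ler_pdivlMl// leNgt mulrC => /negP; apply.
by rewrite truncnS_gt.
Qed.

Lemma int0_parts f phi psi T : 0 <= T -> L1loc f -> D phi psi -> C0 psi ->
  int0 (fun s => phi s * f s) T =
  phi T * int0 f T - int0 (fun s => psi s * int0 f s) T.
Proof.
move=> T0 lf dphi cpsi.
have cphi := D_C0 _ _ dphi.
have cF := int0_L1loc_C0 _ lf.
have lphif := L1locM _ _ cphi lf.
have cpsiF : C0 (fun s => psi s * int0 f s) by apply: C0M.
pose Delta t := int0 (fun s => phi s * f s) t - phi t * int0 f t
  + int0 (fun s => psi s * int0 f s) t.
pose Phi t := int0 (fun s => `|f s|) t.
have [L L0 HL] := C0_bounded psi T T0 cpsi.
suff : Delta T = 0 by rewrite /Delta; lra.
apply: (eq0_of_increments Delta Phi (2 * L)) => //.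
- by rewrite mulr_ge0.
- by rewrite /Delta !int0_0 mulr0 !subr0 addr0.
- by rewrite /Phi int0_0.
move=> s t s0 st tT.
have t0 := le_trans s0 st.
have Fincr u : s <= u -> u <= t -> `|int0 f u - int0 f s| <= Phi t - Phi s.
  move=> su ut; apply: le_trans (le_int0_incr _ _ _ _ s0 su lf (L1loc_norm _ lf) _) _ => //.
  rewrite lerD2r -subr_ge0; apply: le_trans (normr_ge0 _) _.
  exact: le_int0_incr (le_trans s0 su) ut lf (L1loc_norm _ lf) _.
have phiincr u : s <= u -> u <= t -> `|phi u - phi t| <= L * (t - s).
  move=> su ut; have u0 := le_trans s0 su.
  rewrite distrC (D_int0E _ _ dphi cpsi _ t0) (D_int0E _ _ dphi cpsi _ u0).
  rewrite opprD addrACA subrr add0r.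
  apply: le_trans (le_int0_incr _ (fun=> L) _ _ u0 ut (L1loc_C0 _ cpsi) (L1loc_C0 _ (C0_cst L)) _) _.
    move=> x ux xt; apply: HL; last exact: le_trans xt tT.
    exact: le_trans u0 (ltW ux).
  by rewrite !int0_cst// -mulrBr ler_wpM2l// lerB.
have c1 : C0 (fun u => phi u - phi t) by C0_auto.
have l1 : L1loc (fun u => (phi u - phi t) * f u) by apply: L1locM.
have c2 : C0 (fun u => psi u * (int0 f u - int0 f s)) by C0_auto.
(* Recentring [phi] at [t] and [int0 f] at [s] turns the increment of [Delta] into two integrals
   over [s, t], each with a factor that is small on that interval; the boundary terms cancel. *)
have E1 u : 0 <= u -> int0 (fun u => (phi u - phi t) * f u) u =
    int0 (fun s => phi s * f s) u - phi t * int0 f u.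
  move=> u0; rewrite -int0Z// -int0B//; last exact/L1locM/lf/C0_cst.
  by apply: eq_int0 => x _ _; rewrite mulrBl.
have E2 u : 0 <= u -> int0 (fun u => psi u * (int0 f u - int0 f s)) u =
    int0 (fun s => psi s * int0 f s) u - int0 f s * (phi u - phi 0).
  move=> u0; rewrite (D_int0E _ _ dphi cpsi _ u0) [_ 0 + _]addrC addrK.
  rewrite -int0Z//; last exact: L1loc_C0.
  rewrite -int0B//; [|exact: L1loc_C0|by apply: L1loc_C0; C0_auto].
  by apply: eq_int0 => x _ _; ring.
have l3 : L1loc (fun u => L * (t - s) * `|f u|).
  by apply: L1locM; [exact: C0_cst|exact: L1loc_norm].
have l4 : L1loc (fun=> L * (Phi t - Phi s) : R) by apply/L1loc_C0/C0_cst.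
have B1 : `|int0 (fun u => (phi u - phi t) * f u) t -
    int0 (fun u => (phi u - phi t) * f u) s| <= L * (t - s) * (Phi t - Phi s).
  apply: le_trans (le_int0_incr _ _ _ _ s0 st l1 l3 _) _.
    move=> u su ut; rewrite normrM ler_wpM2r//.
    exact: phiincr (ltW su) ut.
  by rewrite !int0Z// -?mulrBr//; exact: L1loc_norm.
have B2 : `|int0 (fun u => psi u * (int0 f u - int0 f s)) t -
    int0 (fun u => psi u * (int0 f u - int0 f s)) s| <=
    L * (t - s) * (Phi t - Phi s).
  apply: le_trans (le_int0_incr _ _ _ _ s0 st (L1loc_C0 _ c2) l4 _) _.
    move=> u su ut; rewrite normrM ler_pM//; last exact: Fincr (ltW su) ut.
    by apply: HL; [exact: le_trans s0 (ltW su)|exact: le_trans ut tT].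
  by rewrite !int0_cst// -mulrBr mulrAC.
have -> : Delta t - Delta s =
    (int0 (fun u => (phi u - phi t) * f u) t -
     int0 (fun u => (phi u - phi t) * f u) s) +
    (int0 (fun u => psi u * (int0 f u - int0 f s)) t -
     int0 (fun u => psi u * (int0 f u - int0 f s)) s).
  by rewrite !E1// !E2// /Delta; ring.
by apply: le_trans (ler_normD _ _) _; rewrite -!mulrA mulr_natl mulr2n !mulrA lerD.
Qed.

End LocallyIntegrable.

(** * Elimination of the forcing term *)

Section Reduction.
Context {R : realType}.
Implicit Types (f p x v : R -> R) (k w : R).

(** Pulling the factor in [t] out of the kernel leaves an integrand free of [t], open to the
    fundamental theorem or to integration by parts. *)
Lemma int0_expR_convolution k f t : 0 <= t -> L1loc f ->
  int0 (fun s => expR (- k * (t - s)) * f s) t =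
  expR (- k * t) * int0 (fun s => expR (k * s) * f s) t.
Proof.
move=> t0 lf; rewrite -int0Z//; last by apply: L1locM => //; C0_auto.
apply: eq_int0 => s _ _; rewrite mulrA -expRD; congr (expR _ * _); ring.
Qed.

Lemma D_expRZ k : D (fun t : R => expR (k * t)) (fun t => k * expR (k * t)).
Proof. by D_solve; ring. Qed.

(** The equation y1' = f - k y1, with k = w^2, holds only almost everywhere, so it is used in
    integrated form. Integrating the kernel by parts produces [Y] as the solution of Y' + k Y =
    [int0 f], and then Y' is [y1] at every positive time. *)
Lemma y1_decomp w f : L1loc f -> exists Y : R -> R,
  [/\ D Y (y1 w f), Y 0 = 0 &
      forall t, 0 <= t -> y1 w f t = int0 f t - w ^+ 2 * Y t].
Proof.
move=> lf; set k := w ^+ 2.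
have cF := int0_L1loc_C0 _ lf.
pose Y t := expR (- k * t) * int0 (fun s => expR (k * s) * int0 f s) t.
have E t : 0 <= t -> y1 w f t = int0 f t - k * Y t.
  move=> t0; rewrite /y1 int0_expR_convolution//.
  rewrite (int0_parts _ _ _ t t0 lf (D_expRZ k)); last by C0_auto.
  have -> : int0 (fun s => k * expR (k * s) * int0 f s) t =
      k * int0 (fun s => expR (k * s) * int0 f s) t.
    rewrite -int0Z//; last by apply: L1loc_C0; C0_auto.
    by apply: eq_int0 => s _ _; rewrite mulrA.
  rewrite mulrBr mulrA -expRD mulNr addNr expR0 mul1r; congr (_ - _).
  by rewrite /Y mulrCA mulNr.
exists Y; split => //; last by rewrite /Y int0_0 mulr0.
have c1 : C0 (fun s => expR (k * s) * int0 f s) by C0_auto.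
have dI := D_int0 _ c1; have d2 := D_expRZ (- k).
apply: D_der (DM _ _ _ _ d2 dI) _ => t t0.
rewrite E ?ltW// /Y mulrA -expRD mulNr addNr expR0; ring.
Qed.

Lemma C0_y1 w f : L1loc f -> C0 (y1 w f).
Proof.
move=> lf; have [Y [[cY _] _ E]] := y1_decomp w f lf.
apply: (C0_ext (fun t => int0 f t - w ^+ 2 * Y t)) => [|t t0].
  have := int0_L1loc_C0 _ lf => cF; C0_auto.
by rewrite E.
Qed.

Lemma D_y2 w f : L1loc f -> D (y2 w f) (fun t => y1 w f t - w ^+ 2 * y2 w f t).
Proof.
move=> lf; set k := w ^+ 2; have cy := C0_y1 w f lf.
have E t : 0 <= t -> y2 w f t =
    expR (- k * t) * int0 (fun s => expR (k * s) * y1 w f s) t.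
  by move=> t0; rewrite /y2 int0_expR_convolution//; exact: L1loc_C0.
have c1 : C0 (fun s => expR (k * s) * y1 w f s) by C0_auto.
have dI := D_int0 _ c1; have d2 := D_expRZ (- k).
apply: D_ext (DM _ _ _ _ d2 dI) _ _ => t t0; first by rewrite E.
rewrite E ?ltW// mulrA -expRD mulNr addNr expR0; ring.
Qed.

(** Both [v] and [y1] contain the rough term [int0 f], which cancels in their difference; what
    remains is a primitive of continuous functions. *)
Lemma is_solution_C1 p w f x v : C0 p -> L1loc f -> is_solution p w f x v ->
  v 0 = 0 ->
  [/\ C0 v, D x v & D (fun t => v t - y1 w f t)
      (fun t => - (p t * v t) - w ^+ 2 * x t + w ^+ 2 * y1 w f t)].
Proof.
move=> cp lf [cv sol] v0; have {}cv : C0 v by [].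
have dx : D x v.
  apply: (D_ext (fun t => x 0 + int0 v t) _ (fun t => 0 + v t)) => [|t t0|t t0].
  - by apply: DD; [exact: D_cst|exact: D_int0].
  - by have [<-] := sol t t0.
  - exact: add0r.
have cx := D_C0 _ _ dx.
split => //; have [Y [dY Y0 E]] := y1_decomp w f lf.
have c1 : C0 (fun t => p t * v t + w ^+ 2 * x t) by C0_auto.
have dI := D_int0 _ c1.
apply: (D_ext (fun t => - int0 (fun t => p t * v t + w ^+ 2 * x t) t + w ^+ 2 * Y t)).
- by D_auto.
- move=> t t0; rewrite E//; have [_ [_ ->]] := sol t t0.
  rewrite v0; have -> : int0 (fun s => f s - p s * v s - w ^+ 2 * x s) t =
     int0 (fun s => f s - (p s * v s + w ^+ 2 * x s)) t.
    by apply: eq_int0 => s _ _; rewrite opprD addrA.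
  by rewrite int0B//; [ring|exact: L1loc_C0].
- by move=> t t0 /=; ring.
Qed.

End Reduction.

(** * Functions that are o(A) at infinity *)

Section Small.
Context {R : realType}.
Implicit Types A F G f g m c y p : R -> R.

(** With [A] constantly 1 this is convergence to 0. The threshold is nonnegative so that facts known
    on the half-line apply beyond it. *)
Definition small A F := forall e : R, 0 < e ->
  exists2 T : R, 0 <= T & forall t : R, T <= t -> `|F t| <= e * A t.

Lemma small_le A F G : small A F -> (forall t, 0 <= t -> `|G t| <= `|F t|) ->
  small A G.
Proof.
move=> sF GF e /sF[T T0 HT]; exists T => // t Tt.
by apply: le_trans (GF t _) (HT t Tt); exact: le_trans T0 Tt.
Qed.

Lemma small_ext A F G : small A F -> (forall t, 0 <= t -> F t = G t) -> small A G.
Proof. by move=> sF FG; apply: small_le sF _ => t /FG ->. Qed.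

Lemma smallD A F G : small A F -> small A G -> small A (fun t => F t + G t).
Proof.
move=> sF sG e e0; have e2 : 0 < e / 2 by rewrite divr_gt0.
have [T T0 HT] := sF _ e2; have [S S0 HS] := sG _ e2.
exists (T + S) => [|t tTS]; first by rewrite addr_ge0.
have /HT ? : T <= t by lra.
have /HS ? : S <= t by lra.
have := ler_normD (F t) (G t); lra.
Qed.

Lemma small_bounded_mul A c F C : 0 <= C -> (forall t, 0 <= t -> `|c t| <= C) ->
  small A F -> small A (fun t => c t * F t).
Proof.
(* [C + 1] replaces [C] because [e] is divided by it and [C] may be 0. *)
move=> C0 cC sF e e0; have C1 : 0 < C + 1 by rewrite ltr_wpDl.
have [T T0 HT] := sF _ (divr_gt0 e0 C1); exists T => // t Tt.
rewrite normrM; have ct : `|c t| <= C + 1.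
  by rewrite (le_trans (cC t (le_trans T0 Tt)))// lerDl.
apply: le_trans (ler_pM (normr_ge0 _) (normr_ge0 _) ct (HT t Tt)) _.
by rewrite mulrA [X in X * _]mulrC divfK// gt_eqF.
Qed.

Lemma smallZ A (a : R) F : small A F -> small A (fun t => a * F t).
Proof. exact: (@small_bounded_mul A (fun=> a) F `|a|). Qed.

Lemma smallN A F : small A F -> small A (fun t => - F t).
Proof. by move=> sF; apply: small_le sF _ => t _; rewrite normrN. Qed.

Lemma small_norm A F : small A F -> small A (fun t => `|F t|).
Proof. by move=> sF; apply: small_le sF _ => t _; rewrite normr_id. Qed.

Lemma normr_cos_le1 (t : R) : `|cos t| <= 1.
Proof. by rewrite ler_norml cos_geN1 cos_le1. Qed.

Lemma normr_sin_le1 (t : R) : `|sin t| <= 1.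
Proof. by rewrite ler_norml sin_geN1 sin_le1. Qed.

Lemma small_cosM A F (a : R) : small A F -> small A (fun t => cos (a * t) * F t).
Proof.
by apply: (small_bounded_mul _ _ _ 1) => // t _; exact: normr_cos_le1.
Qed.

Lemma small_sinM A F (a : R) : small A F -> small A (fun t => sin (a * t) * F t).
Proof.
by apply: (small_bounded_mul _ _ _ 1) => // t _; exact: normr_sin_le1.
Qed.

Lemma small_scale A F : (forall t, 0 <= t -> 0 < A t) ->
  small A (fun t => A t * F t) <-> small (fun=> 1) F.
Proof.
by move=> A0; split=> sF e /sF[T T0 HT]; exists T => // t Tt; have := HT t Tt;
  have At := A0 t (le_trans T0 Tt);
  rewrite normrM (gtr0_norm At) mulr1 [A t * _]mulrC ler_pM2r.
Qed.

Lemma cvgr0_small F : F t @[t --> +oo] --> 0 <-> small (fun=> 1) F.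
Proof.
split=> [/cvgr0Pnorm_le F0 e e0|sF].
  (* The filter gives a bound for t > M, strictly and with [M] of any sign; |M| + 1 is nonnegative
     and lies strictly above [M]. *)
  have [M [_ HM]] := F0 e e0; exists (`|M| + 1) => [|t tM]; first by rewrite addr_ge0.
  rewrite mulr1; apply: HM; apply: lt_le_trans tM.
  by rewrite (le_lt_trans (ler_norm _))// ltrDl ltr01.
apply/cvgr0Pnorm_le => e /sF[T T0 HT]; exists T; split; first exact: num_real.
by move=> t Tt; rewrite -[e]mulr1; exact/HT/ltW.
Qed.

Lemma littleo_small A F : (forall t, 0 < A t) -> F =o_ +oo A <-> small A F.
Proof.
move=> A0; split=> [/eqoP Fo e e0|sF].
  have [M [_ HM]] := Fo e e0; exists (`|M| + 1) => [|t tM]; first by rewrite addr_ge0.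
  have := HM t; rewrite (gtr0_norm (A0 t)); apply; apply: lt_le_trans tM.
  by rewrite (le_lt_trans (ler_norm _))// ltrDl ltr01.
apply/eqoP => e /sF[T T0 HT]; exists T; split; first exact: num_real.
by move=> t Tt; rewrite (gtr0_norm (A0 t)); exact/HT/ltW.
Qed.

(** This is divergence to +oo, not merely the absence of an upper bound. *)
Definition unbounded A := forall M : R,
  exists2 T : R, 0 <= T & forall t, T <= t -> M <= A t.

Lemma small_cst A (a : R) : unbounded A -> small A (fun=> a).
Proof.
move=> uA e e0; have [T T0 HT] := uA (`|a| / e); exists T => // t /HT.
by rewrite ler_pdivrMr// mulrC.
Qed.

(** Once |y| is at most a small [d], increments of [F] are at most [d] times those of [Psi], hence
    at most [d * C * A]. The value of [F] at the starting time is absorbed because [A] tends to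
    +oo. *)
Lemma small_primitive A psi Psi F g y C : unbounded A -> 0 <= C ->
  D Psi psi -> (forall t, 0 <= t -> 0 <= Psi t <= C * A t) ->
  D F g -> (forall t, 0 < t -> `|g t| <= psi t * `|y t|) ->
  (forall t, 0 < t -> 0 <= psi t) -> small (fun=> 1) y -> small A F.
Proof.
move=> uA C0 dPsi bPsi dF gpsi psi0 sy e e0.
have e1 : 0 < e / 2 by rewrite divr_gt0.
have C1 : 0 < C + 1 by rewrite ltr_wpDl.
have [T T0 HT] := sy _ (divr_gt0 e1 C1); set d := e / 2 / (C + 1) in HT.
have d0 : 0 < d by rewrite divr_gt0.
have [S S0 HS] := small_cst A (F T) uA _ e1.
exists (T + S) => [|t tTS]; first by rewrite addr_ge0.
have Tt : T <= t by lra.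
have /HS FT : S <= t by lra.
have t0 : 0 <= t := le_trans T0 Tt.
have gd u : T < u -> `|g u| <= d * psi u.
  move=> Tu; have u0 := le_lt_trans T0 Tu.
  apply: le_trans (gpsi u u0) _; rewrite mulrC ler_wpM2r ?psi0//.
  by have := HT u (ltW Tu); rewrite mulr1.
have dd := D_cst d.
have up : F t - F T <= d * (Psi t - Psi T).
  suff : d * Psi T - F T <= d * Psi t - F t by lra.
  apply: (D_nondecreasing _ _ T T0 (DD _ _ _ _ (DM _ _ _ _ dd dPsi) (DN _ _ dF))) => //.
  by move=> u /gd /=; rewrite mulr0 addr0 subr_ge0; apply: le_trans; exact: ler_norm.
have lo : - (d * (Psi t - Psi T)) <= F t - F T.
  suff : d * Psi T + F T <= d * Psi t + F t by lra.
  apply: (D_nondecreasing _ _ T T0 (DD _ _ _ _ (DM _ _ _ _ dd dPsi) dF)) => //.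
  by move=> u /gd /=; rewrite ler_norml => /andP[? _]; lra.
have A0 : 0 <= A t.
  by have := le_trans (normr_ge0 _) FT; rewrite pmulr_rge0.
have /andP[_ PsiA] := bPsi t t0; have /andP[PsiT _] := bPsi T T0.
have : d * (Psi t - Psi T) <= e / 2 * A t.
  have H1 : d * (Psi t - Psi T) <= d * ((C + 1) * A t).
    by rewrite ler_wpM2l ?(ltW d0)//; lra.
  by apply: le_trans H1 _; rewrite mulrA divfK// gt_eqF.
move: FT; rewrite !ler_norml => /andP[? ?] ?; apply/andP; split; lra.
Qed.

(* The weight [m - p'] covers both the part of an integrand that is dominated by
   the logarithmic derivative of [B] and the integrable part [p']. *)
Lemma small_weight p dp B b m F g y (c K : R) : D p dp -> C0 dp ->
  (forall t, 0 <= t -> 0 < p t) -> (forall t, 0 <= t -> dp t <= 0) ->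
  D B b -> unbounded B -> (forall t, 0 <= t -> 0 < B t) ->
  (forall t, 0 < t -> 0 <= b t) -> C0 m -> (forall t, 0 <= t -> 0 <= m t) ->
  0 <= c -> (forall t, 0 < t -> m t * B t <= c * b t) -> 0 <= K ->
  D F g -> (forall t, 0 < t -> `|g t| <= K * ((m t - dp t) * B t) * `|y t|) ->
  small (fun=> 1) y -> small B F.
Proof.
move=> Dp cdp p0 dp0 dB uB B0 b0 cm m0 c0 mBb K0 dF gK sy.
have cB := D_C0 _ _ dB; have cp := D_C0 _ _ Dp.
pose psi t := (m t - dp t) * B t.
have cpsi : C0 psi by rewrite /psi; C0_auto.
have psi0 t : 0 <= t -> 0 <= psi t.
  move=> t0; have := B0 t t0; have := dp0 t t0; have := m0 t t0 => *.
  by rewrite /psi mulr_ge0//; lra.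
have ple t : 0 <= t -> p t <= p 0.
  move=> t0; rewrite -lerN2.
  apply: (D_nondecreasing _ _ _ (lexx 0) (DN _ _ Dp)) => // u u0.
  by rewrite oppr_ge0 dp0// ltW.
have dPsi := D_int0 _ cpsi.
have Psi0 t : 0 <= t -> 0 <= int0 psi t.
  move=> t0; rewrite -(int0_0 psi).
  by apply: (D_nondecreasing _ _ _ (lexx 0) dPsi) => // u u0; exact/psi0/ltW.
have PsiB t : 0 <= t -> int0 psi t <= (c + p 0) * B t.
  move=> t0.
  (* The derivative of (p 0 - p) B contains - dp B, which cancels the same term of [psi]. The rest
     is nonnegative by m B <= c b and p <= p 0, so the comparison function is nondecreasing. *)
  suff : c * B 0 + (p 0 - p 0) * B 0 - int0 psi 0 <=
         c * B t + (p 0 - p t) * B t - int0 psi t.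
    rewrite int0_0 subrr mul0r subr0 addr0 => H.
    have := mulr_ge0 c0 (ltW (B0 0 (lexx 0))).
    have := mulr_gt0 (p0 t t0) (B0 t t0); lra.
  apply: (D_nondecreasing (fun t => c * B t + (p 0 - p t) * B t - int0 psi t)
    (fun t => c * b t + (p 0 - p t) * b t - m t * B t) 0) => //.
    D_solve; rewrite /psi; ring.
  move=> u u0; have := mBb u u0.
  have : 0 <= (p 0 - p u) * b u by rewrite mulr_ge0 ?b0// subr_ge0 ple// ltW.
  lra.
apply: (small_primitive B (fun t => K * psi t) (fun t => K * int0 psi t) F g y
   (K * (c + p 0))) => //.
- by rewrite mulr_ge0// addr_ge0// ltW// p0.
- by D_solve; ring.
- by move=> t t0; rewrite mulr_ge0 ?Psi0// -mulrA ler_wpM2l// PsiB.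
- by move=> t t0; rewrite mulr_ge0// psi0// ltW.
Qed.

End Small.

(** * The damped oscillator *)

Section DampedOscillator.
Context {R : realType} (w M : R) (p dp A x y r Y : R -> R).
Context (w0 : 0 < w).
Context (Dp : D p dp).
Context (cdp : C0 dp).
Context (p0 : forall t, 0 <= t -> 0 < p t).
Context (dp0 : forall t, 0 <= t -> dp t <= 0).
Context (p2_bounded : forall t, 0 <= t -> int0 (fun s => p s ^+ 2) t <= M).
Context (DA : D A (fun t => p t / 2 * A t)).
Context (A0 : forall t, 0 < A t).
Context (A_unbounded : unbounded A).
Local Notation k := (w ^+ 2).
(* [x] is the solution, [y] and [Y] are the paper's [y_2] and [y_1], and
   [r = x' - y_1] is of class C^1 although [x'] is only continuous. *)
Context (Dx : D x (fun t => r t + Y t)).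
Context (Dy : D y (fun t => Y t - k * y t)).
Context (Dr : D r (fun t => - (p t * (r t + Y t)) - k * x t + k * Y t)).

Let k_gt0 : 0 < k. Proof. by rewrite exprn_gt0. Qed.

Lemma p_le_p0 t : 0 <= t -> p t <= p 0.
Proof.
move=> t0; rewrite -lerN2.
apply: (D_nondecreasing _ _ _ (lexx 0) (DN _ _ Dp)) => // u u0.
by rewrite oppr_ge0 dp0// ltW.
Qed.

Lemma A_nondecreasing s t : 0 <= s -> s <= t -> A s <= A t.
Proof.
apply: (D_nondecreasing _ _ _ (lexx 0) DA) => u u0.
by rewrite mulr_ge0 ?divr_ge0// ltW// p0// ltW.
Qed.

(** As A' = p A / 2, the weight lemma applies with m = p and constant 2. *)
Lemma small_A_weight (F g u : R -> R) (K : R) : 0 <= K -> D F g ->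
  (forall t, 0 < t -> `|g t| <= K * ((p t - dp t) * A t) * `|u t|) ->
  small (fun=> 1) u -> small A F.
Proof.
move=> K0 dF gK su; have cp := D_C0 _ _ Dp.
apply: (small_weight p dp A (fun t => p t / 2 * A t) p F g u 2 K) => //.
- by move=> t t0; rewrite mulr_ge0 ?divr_ge0// ltW// p0// ltW.
- by move=> t /p0/ltW.
- by move=> t t0; rewrite mulrA [2 * _]mulrC divfK.
Qed.

(** The integrating factor of d/dt + k. Its logarithmic derivative is the constant k, so the weight
    m = 1 is admissible with constant 1 / k. *)
Let B t := expR (k * t).

Let small_B_weight (F g u : R -> R) (K : R) : 0 <= K -> D F g ->
  (forall t, 0 < t -> `|g t| <= K * ((1 - dp t) * B t) * `|u t|) ->
  small (fun=> 1) u -> small B F.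
Proof.
move=> K0 dF gK su.
apply: (small_weight p dp B (fun t => k * B t) (fun=> 1) F g u k^-1 K) => //.
- exact: D_expRZ.
- move=> N; exists (`|N| / k) => [|t tN]; first by rewrite divr_ge0// ltW.
  apply: le_trans (expR_ge1Dx _); apply: le_trans (ler_norm _) _.
  by move: tN; rewrite ler_pdivrMr// [t * k]mulrC => tN; lra.
- by move=> t _; exact: expR_gt0.
- by move=> t _; rewrite mulr_ge0 ?expR_ge0// ltW.
- exact: C0_cst.
- by rewrite invr_ge0 ltW.
- by move=> t _; rewrite mul1r mulKf// gt_eqF.
Qed.

Let small_B (u : R -> R) : small B (fun t => B t * u t) -> small (fun=> 1) u.
Proof. by apply: (small_scale B u _).1 => t _; exact: expR_gt0. Qed.

(** Multiplied by [B], the equation reads (B u)' = B s, and the weight lemma gives B u = o(B). *)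
Lemma small_first_order (u s : R -> R) :
  D u (fun t => s t - k * u t) -> small (fun=> 1) s -> small (fun=> 1) u.
Proof.
move=> du ss; apply: small_B; have dB := D_expRZ k.
apply: (small_B_weight _ (fun t => B t * s t) s 1) => //.
- by apply: D_der (DM _ _ _ _ dB du) _ => t t0; rewrite /B; ring.
- move=> t t0; rewrite mul1r normrM (gtr0_norm (expR_gt0 _)) ler_wpM2r//.
  by rewrite ler_peMl ?expR_ge0//; have := dp0 t (ltW t0); lra.
Qed.

Lemma small_x_y : small (fun=> 1) x -> small (fun=> 1) y.
Proof.
(* The terms - k x + p x are chosen so that th' + k th involves [x] but not its derivative. For z =
   x - y one has z' + k z = r + k x, which differs from [th] by a combination of [x] and p x; two
   first-order steps therefore lead to z. *)
move=> sx; pose th t := r t - k * x t + p t * x t.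
have dth : D th (fun t => (dp t - k - k ^+ 2 + k * p t) * x t - k * th t).
  by rewrite /th; D_solve; ring.
have px : small (fun=> 1) (fun t => p t * x t).
  apply: (small_bounded_mul _ _ _ (p 0)) => //; first exact/ltW/p0.
  by move=> t t0; rewrite gtr0_norm ?p0// p_le_p0.
have sth : small (fun=> 1) th.
  apply: small_B; have dB := D_expRZ k.
  (* [dp] is not assumed bounded, so its size is kept in the weight 1 - dp; [K] adds up the bounds
     of the coefficients. *)
  pose K := 1 + k + k ^+ 2 + k * p 0.
  have p00 : 0 <= p 0 by exact/ltW/p0.
  have kp : 0 <= k * p 0 by rewrite mulr_ge0// ltW.
  have k2 : 0 <= k ^+ 2 by rewrite exprn_ge0// ltW.
  have kk := k_gt0.
  apply: (small_B_weight _ (fun t => B t * ((dp t - k - k ^+ 2 + k * p t) * x t)) x K).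
  - by rewrite /K; lra.
  - by apply: D_der (DM _ _ _ _ dB dth) _ => t t0; rewrite /B; ring.
  - move=> t t0; rewrite !normrM (gtr0_norm (expR_gt0 _)) mulrA ler_wpM2r//.
    rewrite mulrA [X in X <= _]mulrC ler_wpM2r ?expR_ge0//.
    have tt := ltW t0; have := dp0 t tt; set d := dp t => d0.
    have : k * p t <= k * p 0 by rewrite ler_wpM2l ?p_le_p0// ltW.
    have : 0 <= k * p t by rewrite mulr_ge0// ltW// p0.
    have Kd : 0 <= (k + k ^+ 2 + k * p 0) * - d.
      by rewrite mulr_ge0 ?oppr_ge0//; lra.
    have -> : K * (1 - d) = K - d + (k + k ^+ 2 + k * p 0) * - d by rewrite /K; ring.
    by rewrite /K ler_norml => ? ?; apply/andP; split; lra.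
  - by [].
have sr : small (fun=> 1) (fun t => r t + k * x t).
  apply: small_ext (smallD _ _ _ sth (smallD _ _ _ (smallZ _ (k *+ 2) _ sx) (smallN _ _ px))) _.
  by move=> t _; rewrite /th; ring.
have sz : small (fun=> 1) (fun t => x t - y t).
  by apply: small_first_order sr; D_solve; ring.
apply: small_ext (smallD _ _ _ sx (smallN _ _ sz)) _ => t _; ring.
Qed.

(** * Variation of constants for Z = A z *)

Let z t := x t - y t.
Let q t := p t ^+ 2 / 4 + dp t / 2.
Let a := int0 (fun s => cos (w * s) * A s * y s).
Let b := int0 (fun s => sin (w * s) * A s * y s).
Let J1 := int0 (fun s => q s * (A s * z s) * sin (w * s)).
Let J2 := int0 (fun s => q s * (A s * z s) * cos (w * s)).
(** [U] and [V] carry the forcing terms with constant coefficients 2 k w and k^2 - k; those with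
    coefficients [p] or [q] are left to [S1] and [S2]. *)
Let U t := 2 * k * w * a t - (k ^+ 2 - k) * b t.
Let V t := 2 * k * w * b t + (k ^+ 2 - k) * a t.
(** This is Z' + (p - 2 k) A y. The correction removes [Y] from the derivative, which becomes (q -
    k) Z + (2 q - k p + k^2 - k) A y. *)
Let zeta t := A t * (p t * z t / 2 + r t - k * y t + p t * y t).
Let P t := w * A t * z t * cos (w * t) - zeta t * sin (w * t).
Let Q t := w * A t * z t * sin (w * t) + zeta t * cos (w * t).
Let S1 t := P t - U t + J1 t.
Let S2 t := Q t - V t - J2 t.

Let cp : C0 p. Proof. exact: D_C0 Dp. Qed.
Let cA : C0 A. Proof. exact: D_C0 DA. Qed.
Let cx : C0 x. Proof. exact: D_C0 Dx. Qed.
Let cy : C0 y. Proof. exact: D_C0 Dy. Qed.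
Let cr : C0 r. Proof. exact: D_C0 Dr. Qed.
Let cz : C0 z. Proof. by rewrite /z; C0_auto. Qed.
Let cq : C0 q.
Proof.
apply: (C0_ext (fun t => p t * p t / 4 + dp t / 2)) => // .
by C0_auto.
Qed.

Let Da : D a (fun s => cos (w * s) * A s * y s).
Proof. by apply: D_int0; C0_auto. Qed.
Let Db : D b (fun s => sin (w * s) * A s * y s).
Proof. by apply: D_int0; C0_auto. Qed.
Let DJ1 : D J1 (fun s => q s * (A s * z s) * sin (w * s)).
Proof. by apply: D_int0; C0_auto. Qed.
Let DJ2 : D J2 (fun s => q s * (A s * z s) * cos (w * s)).
Proof. by apply: D_int0; C0_auto. Qed.

(* [P] and [Q] are [Z = A z] and its quasi-derivative [zeta] in coordinates
   rotating with frequency [w]: they are stationary up to the forcing terms. *)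
Let DS1 : D S1 (fun t => - w * p t * (A t * y t) * cos (w * t)
  - (2 * q t - k * p t) * (A t * y t) * sin (w * t)).
Proof. by rewrite /S1 /U /P /zeta /z; D_solve; rewrite /q /z; field. Qed.

Let DS2 : D S2 (fun t => - w * p t * (A t * y t) * sin (w * t)
  + (2 * q t - k * p t) * (A t * y t) * cos (w * t)).
Proof. by rewrite /S2 /V /Q /zeta /z; D_solve; rewrite /q /z; field. Qed.

(** Rotating back gives w Z = P cos(w t) + Q sin(w t), where P = U + S1 - J1 and Q = V + S2 + J2. *)
Let wAz t : w * (A t * z t) = U t * cos (w * t) + V t * sin (w * t)
  + (S1 t * cos (w * t) + S2 t * sin (w * t))
  + (J2 t * sin (w * t) - J1 t * cos (w * t)).
Proof.
transitivity (w * (A t * z t) * (cos (w * t) ^+ 2 + sin (w * t) ^+ 2)).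
  by rewrite cos2Dsin2 mulr1.
by rewrite /S1 /S2 /P /Q; ring.
Qed.

(** Monotonicity of [p] gives p^2 <= p(0) p, which places [q] under the weight [p - dp]. *)
Let q_le t : 0 <= t -> `|q t| <= (p 0 + 1) * (p t - dp t).
Proof.
move=> t0; have pt := p0 t t0; have := dp0 t t0; have := p_le_p0 t t0.
rewrite /q; set d := dp t => pp d0.
have H1 : p t ^+ 2 <= p 0 * p t by rewrite expr2 ler_wpM2r// ltW.
have H2 : 0 <= p t ^+ 2 by rewrite sqr_ge0.
have H3 : 0 <= p 0 * - d by rewrite mulr_ge0 ?oppr_ge0//; lra.
have -> : (p 0 + 1) * (p t - d) = p 0 * p t + p 0 * - d + p t - d by ring.
rewrite ler_norml; apply/andP; split; lra.
Qed.

Let weight_ge t : 0 <= t -> p t <= p t - dp t.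
Proof. by move=> /dp0; lra. Qed.

(** One estimate serves both remainders: (c, s) is (cos, - sin) for [S1], up to sign conventions of
    the product, and (sin, cos) for [S2]. *)
Let forcing_bound t (c s : R) : 0 <= t -> `|c| <= 1 -> `|s| <= 1 ->
  `|- w * p t * (A t * y t) * c + (2 * q t - k * p t) * (A t * y t) * s|
  <= (w + 2 * (p 0 + 1) + k) * ((p t - dp t) * A t) * `|y t|.
Proof.
move=> t0 c1 s1; have At := A0 t; have pt := p0 t t0; have k0 := k_gt0.
have wt := weight_ge t t0; have := q_le t t0; set qt := q t => qle.
set d := p t - dp t in qle wt *.
have -> : - w * p t * (A t * y t) * c + (2 * qt - k * p t) * (A t * y t) * s =
   (A t * y t) * (- (w * p t) * c + (2 * qt - k * p t) * s) by ring.
rewrite normrM normrM (gtr0_norm At).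
rewrite [X in _ <= X](_ : _ = A t * `|y t| * ((w + 2 * (p 0 + 1) + k) * d)); last by ring.
rewrite ler_wpM2l ?mulr_ge0 ?(ltW At)//.
have wp : 0 < w * p t by exact: mulr_gt0.
have kp : 0 < k * p t by exact: mulr_gt0.
have H1 : w * p t <= w * d by rewrite ler_wpM2l// ltW.
have H2 : k * p t <= k * d by rewrite ler_wpM2l// ltW.
have H3 : `|- (w * p t) * c| <= w * d.
  rewrite normrM normrN (gtr0_norm wp); apply: (le_trans _ H1).
  by rewrite ler_piMr// ltW.
have H4 : `|(2 * qt - k * p t) * s| <= 2 * ((p 0 + 1) * d) + k * d.
  apply: (@le_trans _ _ `|2 * qt - k * p t|); first by rewrite normrM ler_piMr.
  apply: le_trans (ler_normB _ _) _; apply: lerD.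
    by rewrite normrM ger0_norm// ler_pM2l.
  by rewrite (gtr0_norm kp).
apply: le_trans (ler_normD _ _) _; lra.
Qed.

Let K_ge0 : 0 <= w + 2 * (p 0 + 1) + k.
Proof. by have := p0 0 (lexx 0); have := k_gt0; move: w0 => *; lra. Qed.

Let small_S1 : small (fun=> 1) y -> small A S1.
Proof.
apply: (small_A_weight _ _ _ (w + 2 * (p 0 + 1) + k) K_ge0 DS1) => t t0.
have := forcing_bound t (cos (w * t)) (- sin (w * t)) (ltW t0).
rewrite normrN mulrN; apply; [exact: normr_cos_le1|exact: normr_sin_le1].
Qed.

Let small_S2 : small (fun=> 1) y -> small A S2.
Proof.
apply: (small_A_weight _ _ _ (w + 2 * (p 0 + 1) + k) K_ge0 DS2) => t t0.
by apply: forcing_bound (ltW t0) _ _; [exact: normr_sin_le1|exact: normr_cos_le1].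
Qed.

Let qAz_bound (u : R -> R) t (c : R) : 0 <= t -> `|c| <= 1 ->
  `|q t * (A t * u t) * c| <= (p 0 + 1) * ((p t - dp t) * A t) * `|u t|.
Proof.
move=> t0 c1; rewrite normrM; apply: (@le_trans _ _ `|q t * (A t * u t)|).
  by rewrite ler_piMr.
rewrite normrM normrM (gtr0_norm (A0 t)) !mulrA.
by rewrite ler_wpM2r// ler_wpM2r ?q_le// ltW.
Qed.

Let p01 : 0 <= p 0 + 1. Proof. by have := p0 0 (lexx 0); lra. Qed.

Let small_J1 : small (fun=> 1) z -> small A J1.
Proof.
apply: (small_A_weight _ _ _ (p 0 + 1) p01 DJ1) => t t0.
by apply: qAz_bound (ltW t0) _; exact: normr_sin_le1.
Qed.

Let small_J2 : small (fun=> 1) z -> small A J2.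
Proof.
apply: (small_A_weight _ _ _ (p 0 + 1) p01 DJ2) => t t0.
by apply: qAz_bound (ltW t0) _; exact: normr_cos_le1.
Qed.

Let small_trig (F G : R -> R) : small A F -> small A G ->
  small A (fun t => F t * cos (w * t) + G t * sin (w * t)).
Proof.
move=> sF sG.
apply: small_ext (smallD _ _ _ (small_cosM _ _ w sF) (small_sinM _ _ w sG)) _.
by move=> t _; rewrite [F t * _]mulrC [G t * _]mulrC.
Qed.

Let q_integrable : exists N, forall t, 0 <= t -> int0 (fun s => `|q s|) t <= N.
Proof.
exists (M / 4 + p 0 / 2) => t t0.
have c1 : C0 (fun s => `|q s|) by C0_auto.
have d1 := D_int0 _ c1.
have c2 : C0 (fun s => p s ^+ 2) by apply: (C0_ext (fun s => p s * p s)) => //; C0_auto.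
have d2 := D_int0 _ c2.
(* [E] is nondecreasing because |q| <= p^2 / 4 - dp / 2; square integrability of [p] enters here. *)
pose E u := int0 (fun s => p s ^+ 2) u / 4 - p u / 2 - int0 (fun s => `|q s|) u.
have : E 0 <= E t.
  have dE : D E (fun u => p u ^+ 2 / 4 - dp u / 2 - `|q u|).
    by rewrite /E; D_solve; ring.
  apply: (D_nondecreasing _ _ _ (lexx 0) dE) => // u u0.
  have := dp0 u (ltW u0); have := sqr_ge0 (p u).
  by rewrite subr_ge0 ler_norml /q => ? ?; apply/andP; split; lra.
rewrite /E !int0_0; have := p2_bounded t t0; have := p0 t t0; lra.
Qed.

Let small_UV : small A a -> small A b -> small A U /\ small A V.
Proof.
move=> sa sb; split.
  exact: smallD (smallZ _ _ _ sa) (smallN _ _ (smallZ _ _ _ sb)).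
exact: smallD (smallZ _ _ _ sb) (smallZ _ _ _ sa).
Qed.

(* Gronwall: [W] majorizes [J1] and [J2], and the integrating factor [G] is
   bounded away from [0] because [q] is integrable. *)
Lemma small_x_of_ab : small (fun=> 1) y -> small A a -> small A b ->
  small (fun=> 1) x.
Proof.
move=> sy sa sb; have [sU sV] := small_UV sa sb.
have [N HN] := q_integrable.
pose s t := U t * cos (w * t) + V t * sin (w * t)
  + (S1 t * cos (w * t) + S2 t * sin (w * t)).
have ss : small A s by apply: smallD; apply: small_trig => //; auto.
have cs : C0 s.
  have cS1 := D_C0 _ _ DS1; have cS2 := D_C0 _ _ DS2.
  by rewrite /s /U /V; C0_auto.
have cW : C0 (fun t => `|q t| * (A t * `|z t|)) by C0_auto.
pose W := int0 (fun t => `|q t| * (A t * `|z t|)).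
have dW : D W (fun t => `|q t| * (A t * `|z t|)) by exact: D_int0.
have J_le (c : R -> R) t : C0 c -> (forall t, `|c t| <= 1) -> 0 <= t ->
    `|int0 (fun s => q s * (A s * z s) * c s) t| <= W t.
  move=> cc c1 t0; have c3 : C0 (fun s => q s * (A s * z s) * c s) by C0_auto.
  have := le_int0_incr _ _ 0 t (lexx 0) t0 (L1loc_C0 _ c3) (L1loc_C0 _ cW).
  rewrite !int0_0 !subr0; apply=> u u0 ut; rewrite normrM.
  apply: (@le_trans _ _ `|q u * (A u * z u)|); first by rewrite ler_piMr.
  by rewrite !normrM (gtr0_norm (A0 u)).
have Az_le t : 0 <= t -> w * (A t * `|z t|) <= `|s t| + 2 * W t.
  move=> t0; have -> : w * (A t * `|z t|) = `|w * (A t * z t)|.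
    by rewrite !normrM (gtr0_norm (A0 t)) (gtr0_norm w0).
  rewrite wAz -/(s t); apply: le_trans (ler_normD _ _) _; rewrite lerD2l.
  apply: le_trans (ler_normB _ _) _.
  have -> : 2 * W t = W t * 1 + W t * 1 by ring.
  rewrite !normrM; apply: lerD; apply: ler_pM => //.
  - by apply: (J_le (fun t => cos (w * t))) => [|u|//]; [C0_auto|exact: normr_cos_le1].
  - exact: normr_sin_le1.
  - by apply: (J_le (fun t => sin (w * t))) => [|u|//]; [C0_auto|exact: normr_sin_le1].
  - exact: normr_cos_le1.
have cqa : C0 (fun t => `|q t|) by C0_auto.
pose I := int0 (fun t => `|q t|).
have dI : D I (fun t => `|q t|) by exact: D_int0.
pose G t := expR (- (2 / w) * I t).
have cS : C0 (fun t => `|q t| * (`|s t| / w)) by C0_auto.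
pose S := int0 (fun t => `|q t| * (`|s t| / w)).
have dS : D S (fun t => `|q t| * (`|s t| / w)) by exact: D_int0.
have sS : small A S.
  (* With u = |s| / (w A), which tends to 0 because s = o(A), the integrand of [S] is |q| A u and
     falls under the weight lemma. *)
  apply: (small_A_weight _ _ (fun t => `|s t| / (w * A t)) (p 0 + 1) p01 dS) => [t t0|].
    have := qAz_bound (fun t => `|s t| / (w * A t)) t 1 (ltW t0).
    rewrite normr1 mulr1 => /(_ (lexx 1)); apply: le_trans.
    have An : A t != 0 by rewrite gt_eqF.
    have wn : w != 0 by rewrite gt_eqF.
    have -> : A t * (`|s t| / (w * A t)) = `|s t| / w by field; rewrite wn An.
    by rewrite !normrM normr_id.
  apply: (small_scale A _ (fun t _ => A0 t)).1.
  apply: small_ext (smallZ _ (w^-1) _ (small_norm _ _ ss)) _ => t _.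
  by field; rewrite !gt_eqF.
have WG t : 0 <= t -> W t * G t <= S t.
  move=> t0; rewrite -subr_ge0.
  have -> : 0 = S 0 - W 0 * G 0 by rewrite /S /W !int0_0 mul0r subrr.
  (* Since w A |z| <= |s| + 2 W, the derivative of W G is at most G |q| |s| / w, and G <= 1. *)
  have dE : D (fun t => S t - W t * G t) (fun t => `|q t| * ((`|s t| / w)
      - G t * (A t * `|z t| - 2 / w * W t))).
    by rewrite /G; D_solve; ring.
  apply: (D_nondecreasing _ _ _ (lexx 0) dE) => // u u0.
  rewrite mulr_ge0// subr_ge0.
  have H : A u * `|z u| - 2 / w * W u <= `|s u| / w.
    rewrite ler_pdivlMr// mulrBl [2 / w * _ * _]mulrAC divfK ?gt_eqF//.
    by have := Az_le u (ltW u0); lra.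
  apply: le_trans (ler_wpM2l (expR_ge0 _) H) _.
  rewrite ler_piMl ?divr_ge0//; first exact: ltW.
  rewrite -[X in _ <= X]expR0 ler_expR mulNr oppr_le0 mulr_ge0 ?divr_ge0//.
    exact: ltW.
  rewrite -(int0_0 (fun t => `|q t|)).
  by apply: (D_nondecreasing _ _ _ (lexx 0) dI) => //; exact: ltW.
have sW : small A W.
  apply: (@small_le _ A (fun t => expR (2 / w * N) * S t)); first exact: smallZ.
  move=> t t0.
  have W0 : 0 <= W t.
    (* The choice c = 1 bounds [W] below by an absolute value. *)
    apply: le_trans (normr_ge0 _) (J_le (fun=> 1) t (C0_cst _) _ t0) => _.
    by rewrite normr1.
  rewrite (ger0_norm W0); apply: le_trans (ler_norm _).
  have GN : expR (- (2 / w * N)) <= G t.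
    by rewrite ler_expR mulNr lerN2 ler_wpM2l ?HN// divr_ge0// ltW.
  have := ler_wpM2l W0 GN => /le_trans/(_ (WG t t0)).
  rewrite expRN -[W t * _]/(W t / _) ler_pdivrMr ?expR_gt0//.
  by rewrite [S t * _]mulrC.
have sz : small (fun=> 1) z.
  apply: (small_scale A _ (fun t _ => A0 t)).1.
  apply: (@small_le _ A (fun t => w^-1 * (`|s t| + 2 * W t))).
    by apply: smallZ; apply: smallD; [exact: small_norm|exact: smallZ].
  move=> t t0; apply: le_trans (ler_norm _).
  by rewrite normrM (gtr0_norm (A0 t)) ler_pdivlMl// Az_le.
by apply: small_ext (smallD _ _ _ sz sy) _ => t _; rewrite /z subrK.
Qed.

(** * Shift by a quarter period *)

Let tau := pi / 2 / w.

Let tau_gt0 : 0 < tau.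
Proof. by rewrite !divr_gt0// pi_gt0. Qed.

Let KA := expR (p 0 / 2 * tau).

(** As p <= p(0), the product of A(u) and exp(- p(0) u / 2) is nonincreasing in u, so a shift of
    fixed length costs only a constant factor. *)
Let A_shift t : 0 <= t -> A (t + tau) <= KA * A t.
Proof.
move=> t0; pose g u := - (A u * expR (- (p 0 / 2) * u)).
have dg : D g (fun u => A u * expR (- (p 0 / 2) * u) * (p 0 / 2 - p u / 2)).
  by rewrite /g; D_solve; ring.
have : g t <= g (t + tau).
  apply: (D_nondecreasing _ _ _ (lexx 0) dg) => // [u u0|].
    rewrite mulr_ge0 ?mulr_ge0 ?expR_ge0 ?(ltW (A0 u))//.
    by have := p_le_p0 u (ltW u0); lra.
  by rewrite lerDl ltW.
rewrite /g lerN2 mulrDr expRD mulrA mulrAC -[X in _ <= X -> _]mulr1.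
rewrite [X in _ <= X * 1 -> _]mulrC => H.
have e0 := expR_gt0 (- (p 0 / 2) * t).
move: H; rewrite mulr1 [expR _ * A t]mulrC ler_pM2r// mulNr expRN.
by rewrite ler_pdivrMr ?expR_gt0// mulrC.
Qed.

Let small_shift (F : R -> R) : small A F -> small A (fun t => F (t + tau)).
Proof.
move=> sF e e0; have K0 : 0 < KA by exact: expR_gt0.
have [T T0 HT] := sF _ (divr_gt0 e0 K0); exists T => // t Tt.
have t0 := le_trans T0 Tt.
apply: le_trans (HT _ _) _; first by rewrite ler_wpDr// ltW.
rewrite mulrAC ler_pdivrMr// -mulrA ler_wpM2l ?(ltW e0)//.
by rewrite mulrC A_shift.
Qed.

(** The window has fixed length [tau]; on it [A] is at most A(t + tau) <= KA A(t) while [y] is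
    small. The tolerance e / (tau KA) offsets both factors. *)
Let small_increment (c : R -> R) : C0 c -> (forall t, `|c t| <= 1) ->
  small (fun=> 1) y ->
  small A (fun t => int0 (fun s => c s * A s * y s) (t + tau) -
                    int0 (fun s => c s * A s * y s) t).
Proof.
move=> cc c1 sy e e0; have K0 : 0 < KA by exact: expR_gt0.
have [T T0 HT] := sy _ (divr_gt0 e0 (mulr_gt0 tau_gt0 K0)).
set d := e / _ in HT; have d0 : 0 <= d by apply/ltW/divr_gt0 => //; exact: mulr_gt0.
exists T => // t Tt; have t0 := le_trans T0 Tt.
have cI : C0 (fun s => c s * A s * y s) by C0_auto.
have tt : t <= t + tau by rewrite lerDl ltW.
apply: le_trans (le_int0_incr _ (fun=> A (t + tau) * d) _ _ t0 tt
  (L1loc_C0 _ cI) (L1loc_C0 _ (C0_cst _)) _) _.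
  move=> u tu ut; rewrite !normrM (gtr0_norm (A0 u)).
  have u0 := le_trans t0 (ltW tu).
  apply: ler_pM => //; first by rewrite mulr_ge0// ltW.
    rewrite -[X in _ <= X]mul1r; apply: ler_pM => //; first exact: ltW.
    exact: A_nondecreasing.
  by rewrite -[d]mulr1; apply: HT; exact: le_trans Tt (ltW tu).
rewrite !int0_cst//; last exact: le_trans tt.
rewrite -mulrBr [t + tau]addrC addrK.
apply: (@le_trans _ _ (KA * A t * d * tau)).
  by rewrite ler_wpM2r ?(ltW tau_gt0)// ler_wpM2r// [tau + t]addrC A_shift.
rewrite le_eqVlt; apply/orP; left; apply/eqP; rewrite /d; field.
by rewrite !gt_eqF.
Qed.

(* A single combination of the two slowly varying amplitudes [U], [V] is known
   to be small; a shift by a quarter period gives the conjugate combination. *)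
Lemma small_ab_of_x : small (fun=> 1) x -> small (fun=> 1) y ->
  small A a /\ small A b.
Proof.
move=> sx sy.
have sz : small (fun=> 1) z by exact: smallD sx (smallN _ _ sy).
pose h t := U t * cos (w * t) + V t * sin (w * t).
have sh : small A h.
  have sZ : small A (fun t => w * (A t * z t)).
    by apply: smallZ; exact: (small_scale A _ (fun t _ => A0 t)).2.
  have sS := small_trig _ _ (small_S1 sy) (small_S2 sy).
  have sJ := small_trig _ _ (smallN _ _ (small_J1 sz)) (small_J2 sz).
  apply: small_ext (smallD _ _ _ sZ (smallN _ _ (smallD _ _ _ sS sJ))) _ => t _.
  by rewrite wAz /h; ring.
have sda := small_increment (fun s => cos (w * s)) _ (fun s => normr_cos_le1 _) sy.
have {}sda := sda ltac:(C0_auto).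
have sdb := small_increment (fun s => sin (w * s)) _ (fun s => normr_sin_le1 _) sy.
have {}sdb := sdb ltac:(C0_auto).
have sdU : small A (fun t => U (t + tau) - U t).
  apply: small_ext (smallD _ _ _ (smallZ _ (2 * k * w) _ sda)
    (smallZ _ (- (k ^+ 2 - k)) _ sdb)) _ => t _.
  by rewrite /U /a /b; ring.
have sdV : small A (fun t => V (t + tau) - V t).
  apply: small_ext (smallD _ _ _ (smallZ _ (2 * k * w) _ sdb)
    (smallZ _ (k ^+ 2 - k) _ sda)) _ => t _.
  by rewrite /V /a /b; ring.
pose h2 t := V t * cos (w * t) - U t * sin (w * t).
have wtau t : w * (t + tau) = w * t + pi / 2.
  by rewrite mulrDr [w * tau]mulrC divfK// gt_eqF.
have [_ cpi] := @pihalf_02_cos_pihalf R.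
have ctau t : cos (w * (t + tau)) = - sin (w * t).
  by rewrite wtau cosD cpi sin_pihalf mulr0 mulr1 sub0r.
have stau t : sin (w * (t + tau)) = cos (w * t).
  by rewrite wtau sinD cpi sin_pihalf mulr0 mulr1 add0r.
(* The shift replaces (cos, sin) by (- sin, cos), so h(t + tau) equals [h2] up to the increments of
   [U] and [V]. *)
have sh2 : small A h2.
  apply: small_ext (smallD _ _ _ (small_shift _ sh)
    (small_trig _ _ (smallN _ _ sdV) sdU)) _ => t _.
  by rewrite /h /h2 ctau stau; ring.
have cs2 t : cos (w * t) ^+ 2 = 1 - sin (w * t) ^+ 2.
  by rewrite -(cos2Dsin2 (w * t)) addrK.
(* (h, h2) is (U, V) rotated through the angle w t; rotating back recovers [U] and [V]. *)
have sU : small A U.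
  apply: small_ext (small_trig _ _ sh (smallN _ _ sh2)) _ => t _.
  transitivity (U t * (cos (w * t) ^+ 2 + sin (w * t) ^+ 2)).
    by rewrite /h /h2; ring.
  by rewrite cos2Dsin2 mulr1.
have sV : small A V.
  apply: small_ext (small_trig _ _ sh2 sh) _ => t _.
  transitivity (V t * (cos (w * t) ^+ 2 + sin (w * t) ^+ 2)).
    by rewrite /h /h2; ring.
  by rewrite cos2Dsin2 mulr1.
(* [d] is the determinant of the linear map from (a, b) to (U, V), positive because 2 k w > 0; the
   map is then inverted. *)
pose d := (2 * k * w) ^+ 2 + (k ^+ 2 - k) ^+ 2.
have d0 : d != 0.
  rewrite gt_eqF// ltr_wpDr ?sqr_ge0// exprn_gt0// mulr_gt0//.
  by rewrite mulr_gt0.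
split.
  apply: small_ext (smallD _ _ _ (smallZ _ (2 * k * w / d) _ sU)
    (smallZ _ ((k ^+ 2 - k) / d) _ sV)) _ => t _.
  by rewrite /U /V; move: d0; rewrite /d => d0; field.
apply: small_ext (smallD _ _ _ (smallZ _ (2 * k * w / d) _ sV)
  (smallZ _ (- (k ^+ 2 - k) / d) _ sU)) _ => t _.
by rewrite /U /V; move: d0; rewrite /d => d0; field.
Qed.

Theorem small_x_iff : small (fun=> 1) x <->
  [/\ small (fun=> 1) y, small A a & small A b].
Proof.
split=> [sx|[]]; last exact: small_x_of_ab.
by have sy := small_x_y sx; have [] := small_ab_of_x sx sy.
Qed.

End DampedOscillator.

(** * Improper integrals over the half-line *)

Section ImproperIntegrals.
Context {R : realType}.
Implicit Types g : R -> R.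
Local Notation mu := (@lebesgue_measure R).

Lemma C0_derivable g : (forall t : R, 0 <= t -> derivable g t 1) -> C0 g.
Proof.
move=> dg; apply: derivable_within_continuous => t.
by rewrite in_itv/= andbT => /dg.
Qed.

Lemma nondecreasing_int0 g : (forall t, 0 <= t -> 0 <= g t) -> C0 g ->
  nondecreasing_fun (int0 g).
Proof.
move=> g0 cg s t st; have [s0|s0] := ltP s 0.
  (* For negative [s] the interval [0, s] is empty and [int0 g s] is 0. *)
  rewrite {1}/int0 set_itv_ge ?bnd_simp -?ltNge// Rintegral_set0.
  by apply: Rintegral_ge0 => u/=; rewrite in_itv/= => /andP[/g0].
by apply: (D_nondecreasing _ _ _ (lexx 0) (D_int0 _ cg)) => // u /ltW/g0.
Qed.

(** A bounded nondecreasing primitive would converge, and the fundamental theorem on the half-line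
    would then make the improper integral finite. *)
Lemma unbounded_int0 g : (forall t, 0 <= t -> 0 <= g t) -> C0 g ->
  (\int[mu]_(t in `[0%R, +oo[) (g t)%:E = +oo)%E -> unbounded (int0 g).
Proof.
move=> g0 cg intg N; have ndg := nondecreasing_int0 _ g0 cg.
apply: contrapT => nN; suff : (\int[mu]_(t in `[0%R, +oo[) (g t)%:E < +oo)%E.
  by rewrite intg ltxx.
have ubN t : int0 g t <= N.
  rewrite leNgt; apply/negP => Nt; apply: nN; exists `|t| => // u tu.
  by apply: le_trans (ltW Nt) (ndg _ _ _); exact: le_trans (ler_norm _) tu.
have cvgI : int0 g t @[t --> +oo] --> sup (range (int0 g)).
  by apply: nondecreasing_cvgr => //; exists N => _ [t _ <-].
have [cI dI] := D_int0 _ cg.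
rewrite (ge0_continuous_FTC2y g0 cg cvgI).
- by rewrite -EFinB ltry.
- by move=> t t0; have [] := dI t t0.
- by have /continuous_within_itvcyP[] := cI.
- move=> t; rewrite in_itv/= andbT => t0; rewrite derive1E.
  by have [_ ->] := dI t t0.
Qed.

Lemma bounded_int0 g : (forall t, 0 <= t -> 0 <= g t) -> C0 g ->
  (\int[mu]_(t in `[0%R, +oo[) (g t)%:E < +oo)%E ->
  exists M, forall t, 0 <= t -> int0 g t <= M.
Proof.
move=> g0 cg intg; exists (fine (\int[mu]_(t in `[0%R, +oo[) (g t)%:E)) => t t0.
have ge0 u : `[0%R, +oo[%classic u -> (0 <= (g u)%:E)%E.
  by move=> /=; rewrite in_itv/= andbT lee_fin => /g0.
apply: fine_le.
- exact: integrable_fin_num (C0_integrable g t cg).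
- by rewrite ge0_fin_numE// integral_ge0.
- apply: ge0_subset_integral => //.
    apply/measurable_realfun.measurable_EFinP.
    exact: measurable_realfun.subspace_continuous_measurable_fun.
  by move=> u /=; rewrite !in_itv/= => /andP[->].
Qed.

End ImproperIntegrals.

(** * Passage from [small] to limits and Landau notation *)

Theorem mainTheorem16 (R : realType) (w : R) (p f x v : R -> R) :
  0 < w ->
  (* p in C^1([0,oo)), p > 0, p' < 0 *)
  (forall t : R, 0 <= t -> derivable p t 1) ->
  {within `[0, +oo[, continuous (derive1 p)} ->
  (forall t : R, 0 <= t -> 0 < p t) ->
  (forall t : R, 0 <= t -> derive1 p t < 0) ->
  (\int[lebesgue_measure]_(t in `[0%R, +oo[) (p t)%:E = +oo)%E ->
  (\int[lebesgue_measure]_(t in `[0%R, +oo[) ((p t) ^+ 2)%:E < +oo)%E ->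
  L1loc f ->
  is_solution p w f x v ->
  x 0 = 0 -> v 0 = 0 ->
  (x t @[t --> +oo] --> 0
   <->
   [/\ y2 w f t @[t --> +oo] --> 0,
       (fun t => int0 (fun s => cos (w * s) * Afun p s * y2 w f s) t)
         =o_ +oo (Afun p)
     & (fun t => int0 (fun s => sin (w * s) * Afun p s * y2 w f s) t)
         =o_ +oo (Afun p)]).
Proof.
move=> w0 dp cdp p0 dp0 intp intp2 lf sol x0 v0.
have cp : C0 p := C0_derivable p dp.
have Dp : D p (derive1 p).
  split=> // t t0; apply: DeriveDef; first exact: dp (ltW t0).
  by rewrite derive1E.
have [cv Dx Dr] := is_solution_C1 p w f x v cp lf sol v0.
have Dy := D_y2 w f lf; have cY := C0_y1 w f lf.
have p0' t : 0 <= t -> 0 <= p t by move=> /p0/ltW.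
have [M HM] : exists M, forall t, 0 <= t -> int0 (fun s => p s ^+ 2) t <= M.
  apply: bounded_int0 => // [t _|]; first exact: sqr_ge0.
  by apply: (C0_ext (fun s => p s * p s)) => //; C0_auto.
have A0 t : 0 < Afun p t by exact: expR_gt0.
have DI := D_int0 _ cp.
have DA : D (Afun p) (fun t => p t / 2 * Afun p t).
  by rewrite /Afun; D_solve; ring.
have uA : unbounded (Afun p).
  (* The level 2 N compensates the factor 1/2 in the exponent of [Afun], which is at least 1 plus
     that exponent. *)
  move=> N; have [T T0 HT] := unbounded_int0 p p0' cp intp (2 * N).
  exists T => // t /HT Nt; apply: le_trans (expR_ge1Dx _).
  by rewrite mulrC; lra.
have Dx' : D x (fun t => (v t - y1 w f t) + y1 w f t).
  by apply: D_der Dx _ => t _; rewrite subrK.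
have Dr' : D (fun t => v t - y1 w f t)
    (fun t => - (p t * ((v t - y1 w f t) + y1 w f t)) - w ^+ 2 * x t
              + w ^+ 2 * y1 w f t).
  by apply: D_der Dr _ => t _; rewrite subrK.
have [xP Px] := small_x_iff w M p (derive1 p) (Afun p) x (y2 w f) _ (y1 w f) w0 Dp
  cdp p0 (fun t t0 => ltW (dp0 t t0)) HM DA A0 uA Dx' Dy Dr'.
split=> [/cvgr0_small/xP[sy sa sb]|[/cvgr0_small sy ao bo]].
  by split; [exact/cvgr0_small|exact/littleo_small|exact/littleo_small].
apply/cvgr0_small/Px; split=> //; exact/littleo_small.
Qed.
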